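(* Let $1\le k\le n$, let $\mathcal S\subset\mathcal P_n$ be the stabilizer group of a stabilizer code, $D$ a decoding map, and $\tilde G\subset\tilde{\mathcal P}_n$ a nontrivial subgroup. Fix $z>0$ (where $z=p/(3-3p)$, $p\in(0,1)$) and assume $$\frac{W(V\setminus K;z)}{W(V;z)}>\frac{W(U\setminus K;z)}{W(U;z)},$$ where $K$, $U$, $V$ are the sets of correctable, unsuppressed and suppressed errors defined in the context. Then for any $p_{\rm DD}\in[0,1)$ there exists $\varepsilon>0$ (depending on $z$ and $p_{\rm DD}$) such that $F_{\rm Hyb}>F_{\rm QEC}$ for all $p_{\rm QEC}\in[0,\varepsilon)$.
   Context: Paulis. $\mathcal P_n$ is the $n$-qubit Pauli group (with phases $\pm1,\pm i$), $\tilde{\mathcal P}_n=\mathcal P_n/\langle iI\rangle$, and $\pi:\mathcal P_n\to\tilde{\mathcal P}_n$ is the projection. Elements of $\tilde{\mathcal P}_n$ are represented by strings in $\{I,X,Y,Z\}^n$; $\mathrm{wt}(E')$ is the number of non-identity letters. Two elements of $\tilde{\mathcal P}_n$ are said to commute (anticommute) if their representatives in $\mathcal P_n$ do. Code. $\mathcal S\subset\mathcal P_n$ is a subgroup with $2^{n-k}$ elements not containing $-I$. $\mathcal S^*$ is the $\mathbb F_2$-dual of $\mathcal S$; the syndrome $\mathrm{syn}(E')\in\mathcal S^*$ is given by $\mathrm{syn}(E')(s)=1$ iff $E'$ anticommutes with $s$. A decoding map is a map $D:\mathcal S^*\to\tilde{\mathcal P}_n$ with $D(0)=\pi(I)$ and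 $\mathrm{syn}(D(\sigma))=\sigma$ for all $\sigma$. Sets. $T=\pi(\mathcal S)$; $K=\{E'\in\tilde{\mathcal P}_n: D(\mathrm{syn}(E'))E'\in T\}$ (correctable errors); $U=\tilde G^\perp=\{E'\in\tilde{\mathcal P}_n: E'\text{ commutes with every element of }\tilde G\}$ (unsuppressed errors); $V=\tilde{\mathcal P}_n\setminus U$ (suppressed errors). For $A\subset\tilde{\mathcal P}_n$, $W(A;z)=\sum_{E'\in A}z^{\mathrm{wt}(E')}$. Hybrid LDD+QEC protocol. A random error $E'\in\tilde{\mathcal P}_n$ is drawn from the distribution obtained from $(1-p)^{n-\mathrm{wt}(E')}(p/3)^{\mathrm{wt}(E')}$ by multiplying the probabilities of all $E'\in V$ by $p_{\rm DD}$ and renormalizing. The syndrome $\sigma=\mathrm{syn}(E')$ is measured. If $\sigma=0$, the recovery is $R=\pi(I)$. If $\sigma\ne0$, then (independently of $E'$ given $\sigma$) with probability $1-p_{\rm QEC}$ the recovery is $R=D(\sigma)$, and with probability $p_{\rm QEC}$ it is a uniformly random $R\in\tilde{\mathcal P}_n$ with $\mathrm{syn}(R)=\sigma$. $F_{\rm Hyb}$ is the probability that $RE'\in T$ (no logical error). The QEC-only protocol is the same (with the same $p_{\rm QEC}$) with no rescaling, i.e. with $p_{\rm DD}$ replaced by $1$, and $F_{\rm QEC}$ is its fidelity. *)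

(* Defs.v *)
From HB Require Import structures.
From mathcomp Require Import all_boot all_order all_algebra all_fingroup all_field.
From mathcomp Require Import reals.
Set Implicit Arguments.
Unset Strict Implicit.
Unset Printing Implicit Defensive.
Import Order.TTheory GRing.Theory Num.Theory.
Local Open Scope ring_scope.

Inductive letter := LI | LX | LY | LZ.

Definition bits_of_letter (a : letter) : bool * bool :=
  match a with
  | LI => (false, false) | LX => (true, false)
  | LY => (true, true)   | LZ => (false, true)
  end.
Definition letter_of_bits (b : bool * bool) : letter :=
  match b with
  | (false, false) => LI | (true, false) => LX
  | (true, true) => LY   | (false, true) => LZ
  end.
Lemma bits_of_letterK : cancel bits_of_letter letter_of_bits.
Proof. by case. Qed.
HB.instance Definition _ := Finite.copy letter (can_type bits_of_letterK).

Definition lmul (a b : letter) : letter :=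
  match a, b with
  | LI, c | c, LI => c
  | LX, LX | LY, LY | LZ, LZ => LI
  | LX, LY | LY, LX => LZ
  | LY, LZ | LZ, LY => LX
  | LZ, LX | LX, LZ => LY
  end.

(* The product of the letters a and b is i ^ (lphase a b) times lmul a b. *)
Definition lphase (a b : letter) : 'Z_4 :=
  match a, b with
  | LX, LY | LY, LZ | LZ, LX => 1
  | LY, LX | LZ, LY | LX, LZ => 3
  | _, _ => 0
  end.

Definition letter_mx (a : letter) : 'M[algC]_2 :=
  match a with
  | LI => 1%:M
  | LX => \matrix_(r, c) (r != c)%:R
  | LY => \matrix_(r, c) ((r != c)%:R * (-1) ^+ c * 'i)
  | LZ => \matrix_(r, c) ((r == c)%:R * (-1) ^+ r)
  end.

Lemma letter_mxM (a b : letter) :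
  letter_mx a *m letter_mx b = 'i ^+ lphase a b *: letter_mx (lmul a b).
Proof.
have i2 : 'i * 'i = -1 :> algC by rewrite -expr2 sqrCi.
have i3 : 'i ^+ 3 = - 'i :> algC by rewrite exprS expr2 i2 mulrN1.
case: a; case: b => //=; rewrite ?expr0 ?scale1r ?mul1mx ?mulmx1 //;
  apply/matrixP => -[[|[|r]] hr] // -[[|[|c]] hc] //;
  rewrite !mxE !big_ord_recl big_ord0 !mxE /=
    ?(expr0, expr1, mulr1, mul1r, mulr0, mul0r, addr0, add0r, i3, mulrN,
      mulNr, mulrN1, mulN1r, opprK, oppr0, i2) //.
Qed.

(* (a, w) stands for i ^ a times the tensor product of the letters of w. *)
Definition pauli (n : nat) : Type := ('Z_4 * {ffun 'I_n -> letter})%type.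
HB.instance Definition _ n := Finite.on (pauli n).

Section PauliGroup.
Variable n : nat.
Implicit Types x y : pauli n.

Definition pauli_mul x y : pauli n :=
  (x.1 + y.1 + \sum_i lphase (x.2 i) (y.2 i), [ffun i => lmul (x.2 i) (y.2 i)]).
Definition pauli_one : pauli n := (0, [ffun => LI]).
Definition pauli_inv x : pauli n := (- x.1, x.2).

Lemma pauli_mulA : associative pauli_mul.
Proof.
move=> x y z; rewrite /pauli_mul /=; congr (_, _); last first.
  by apply/ffunP => i; rewrite !ffunE; case: (x.2 i) (y.2 i) (z.2 i) => [] [] [].
rewrite -!addrA; congr (_ + (_ + _)); rewrite [RHS]addrCA; congr (_ + _).
rewrite -!big_split /=; apply: eq_bigr => i _; rewrite !ffunE.
by apply/eqP; case: (x.2 i) (y.2 i) (z.2 i) => [] [] [].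
Qed.

Lemma pauli_mul1 : left_id pauli_one pauli_mul.
Proof.
move=> [a w]; rewrite /pauli_mul /=; congr (_, _); last first.
  by apply/ffunP => i; rewrite !ffunE.
by rewrite big1 ?addr0 ?add0r // => i _; rewrite ffunE.
Qed.

Lemma pauli_mulV : left_inverse pauli_one pauli_inv pauli_mul.
Proof.
move=> [a w]; rewrite /pauli_mul /=; congr (_, _); last first.
  by apply/ffunP => i; rewrite !ffunE; case: (w i).
by rewrite addNr add0r big1 // => i _; case: (w i).
Qed.

HB.instance Definition _ := Finite_isGroup.Build (pauli n)
  pauli_mulA pauli_mul1 pauli_mulV.

Lemma pauli_mulE x y : (x * y)%g = pauli_mul x y.
Proof. by []. Qed.

Definition iI : pauli n := (1, [ffun => LI]).
Definition negI : pauli n := (2%:R, [ffun => LI]).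

Definition commutes x y : bool := (x * y == y * x)%g.
Definition anticommutes x y : bool := (x * y == negI * (y * x))%g.

Definition letter_anti (a b : letter) : bool := [&& a != LI, b != LI & a != b].
Definition nanti x y : nat := \sum_i letter_anti (x.2 i) (y.2 i).

Lemma phaseM (a : 'Z_4) x :
  (((a, [ffun => LI]) : pauli n) * x)%g = (a + x.1, x.2) :> pauli n.
Proof.
case: x => b w; rewrite pauli_mulE /pauli_mul /=; congr (_, _).
  by rewrite big1 ?addr0 // => i _; rewrite ffunE.
by apply/ffunP => i; rewrite !ffunE.
Qed.

Lemma Mphase (a : 'Z_4) x :
  (x * ((a, [ffun => LI]) : pauli n))%g = (a + x.1, x.2) :> pauli n.
Proof.
case: x => b w; rewrite pauli_mulE /pauli_mul /=; congr (_, _).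
  by rewrite big1 ?addr0 1?addrC // => i _; rewrite ffunE; case: (w i).
by apply/ffunP => i; rewrite !ffunE; case: (w i).
Qed.

Lemma pauli_swap x y :
  (x * y)%g = (2%:R *+ odd (nanti x y) + (y * x)%g.1, (y * x)%g.2) :> pauli n.
Proof.
have mod2 m : 2%:R *+ odd m = 2%:R *+ m :> 'Z_4.
  rewrite -[in RHS](odd_double_half m) -addnn !mulrnDr -mulrnDl.
  by rewrite (_ : 2%:R + 2%:R = 0 :> 'Z_4) ?mul0rn ?addr0 //; apply/eqP.
rewrite mod2; congr (_, _) => /=; last first.
  by apply/ffunP => i; rewrite !ffunE; case: (x.2 i) (y.2 i) => [] [].
rewrite [y.1 + x.1]addrC addrCA; congr (_ + _).
rewrite /nanti -sumrMnr -big_split /=; apply: eq_bigr => i _.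
by apply/eqP; case: (x.2 i) (y.2 i) => [] [].
Qed.

Lemma anticommutesE x y : anticommutes x y = odd (nanti x y).
Proof.
rewrite /anticommutes (pauli_swap x y) phaseM xpair_eqE eqxx andbT.
by rewrite (inj_eq (addIr _)); case: odd.
Qed.

Lemma commutesE x y : commutes x y = ~~ anticommutes x y.
Proof.
rewrite anticommutesE /commutes (pauli_swap x y) [X in _ == X]surjective_pairing.
by rewrite xpair_eqE eqxx andbT -subr_eq0 addrK; case: odd.
Qed.

Lemma anticommutesMr x y1 y2 :
  anticommutes x (y1 * y2)%g = anticommutes x y1 (+) anticommutes x y2.
Proof.
rewrite !anticommutesE /nanti -oddD -big_split /=.
rewrite !(big_morph odd oddD (erefl _)); apply: eq_bigr => i _; rewrite ffunE.
by case: (x.2 i) (y1.2 i) (y2.2 i) => [] [] [].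
Qed.

Definition qpauli : Type := coset_of <[iI]>.
HB.instance Definition _ := FinGroup.on qpauli.

Definition pi (x : pauli n) : qpauli := coset <[iI]> x.

Definition wt (E : qpauli) : nat := #|[set i | (repr E).2 i != LI]|.
Definition qcommutes (E F : qpauli) : bool := commutes (repr E) (repr F).
Definition qanticommutes (E F : qpauli) : bool := anticommutes (repr E) (repr F).

Lemma iIX (m : nat) : (iI ^+ m)%g = (m%:R, [ffun => LI]).
Proof.
elim: m => [//|m IHm]; rewrite expgS IHm phaseM /=.
by rewrite mulrS.
Qed.

Lemma norm_iI x : x \in 'N(<[iI]>)%g.
Proof.
apply: (subsetP (cent_sub _)); rewrite cent_cycle.
by apply/cent1P; rewrite /commute phaseM Mphase.
Qed.

Lemma piM : {morph pi : x y / (x * y)%g}.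
Proof. by move=> x y; rewrite /pi morphM ?norm_iI. Qed.

Lemma piP x y : reflect (x.2 = y.2) (pi x == pi y).
Proof.
apply: (iffP eqP) => [/(rcoset_kercosetP (norm_iI x) (norm_iI y))|exy].
  by case/rcosetP=> _ /cycleP[m ->] ->; rewrite iIX phaseM.
apply/(rcoset_kercosetP (norm_iI x) (norm_iI y))/rcosetP.
exists (iI ^+ (x.1 - y.1)%R)%g; first exact: mem_cycle.
rewrite iIX phaseM natr_Zp subrK -exy; exact: surjective_pairing.
Qed.

Lemma repr_pi x : (repr (pi x)).2 = x.2.
Proof. by apply/piP; rewrite /pi coset_reprK. Qed.

Lemma pi_repr (E : qpauli) : pi (repr E) = E.
Proof. exact: coset_reprK. Qed.

Lemma wt_pi x : wt (pi x) = #|[set i | x.2 i != LI]|.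
Proof. by rewrite /wt repr_pi. Qed.

Lemma qanticommutes_pi x y : qanticommutes (pi x) (pi y) = anticommutes x y.
Proof. by rewrite /qanticommutes !anticommutesE /nanti !repr_pi. Qed.

Lemma qcommutes_pi x y : qcommutes (pi x) (pi y) = commutes x y.
Proof. by rewrite /qcommutes !commutesE; congr negb; exact: qanticommutes_pi. Qed.

End PauliGroup.

Section Code.
Variable n : nat.
Variable S : {group pauli n}.

(* S is elementary abelian when it does not contain -I, so its F_2-dual is the
   set of its additive characters with values in 'F_2. *)
Record dual := Dual {
  dual_val :> {ffun subg_of S -> 'F_2};
  _ : [forall s, forall t, dual_val (s * t)%g == dual_val s + dual_val t] }.
HB.instance Definition _ := [isSub for dual_val].
HB.instance Definition _ := [Finite of dual by <:].

Lemma dual0_subproof : [forall s, forall t,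
  ([ffun => 0] : {ffun subg_of S -> 'F_2}) (s * t)%g == [ffun => 0] s + [ffun => 0] t].
Proof. by apply/forallP => s; apply/forallP => t; rewrite !ffunE addr0. Qed.
Definition dual0 : dual := Dual dual0_subproof.

Definition syn_fun (E : qpauli n) : {ffun subg_of S -> 'F_2} :=
  [ffun s => (qanticommutes E (pi (sgval s)))%:R].
Lemma syn_subproof (E : qpauli n) :
  [forall s, forall t, syn_fun E (s * t)%g == syn_fun E s + syn_fun E t].
Proof.
apply/forallP => s; apply/forallP => t; rewrite !ffunE /=.
rewrite -[E]pi_repr !qanticommutes_pi anticommutesMr.
by apply/eqP; case: anticommutes; case: anticommutes; apply/val_inj.
Qed.
Definition syn (E : qpauli n) : dual := Dual (syn_subproof E).

Lemma syn_pi (x : pauli n) (s : subg_of S) :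
  syn (pi x) s = (anticommutes x (sgval s))%:R.
Proof. by rewrite ffunE qanticommutes_pi. Qed.

Definition stabilizer_group (k : nat) : Prop :=
  #|S| = (2 ^ (n - k))%N /\ negI n \notin S.

Definition decoding_map (D : dual -> qpauli n) : Prop :=
  D dual0 = pi 1%g /\ forall sigma, syn (D sigma) = sigma.

Definition trivial_errors : {set qpauli n} := [set pi s | s in S].

Definition correctable (D : dual -> qpauli n) : {set qpauli n} :=
  [set E | (D (syn E) * E)%g \in trivial_errors].

End Code.

Section Weights.
Variable n : nat.

Definition unsuppressed (G : {group qpauli n}) : {set qpauli n} :=
  [set E | [forall F in G, qcommutes E F]].

Definition suppressed (G : {group qpauli n}) : {set qpauli n} :=
  ~: unsuppressed G.

Definition weight_enum (R : realType) (A : {set qpauli n}) (z : R) : R :=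
  \sum_(E in A) z ^+ wt E.

End Weights.

Section Protocol.
Variables (R : realType) (n : nat) (S : {group pauli n}).
Variables (D : dual S -> qpauli n) (G : {group qpauli n}).
Implicit Types (p pDD pQEC : R) (E : qpauli n) (sigma : dual S).

Definition depolarizing p E : R := (1 - p) ^+ (n - wt E) * (p / 3) ^+ wt E.

Definition rescaled p pDD E : R :=
  (if E \in suppressed G then pDD else 1) * depolarizing p E.

Definition error_prob p pDD E : R :=
  rescaled p pDD E / \sum_F rescaled p pDD F.

(* The conditional probability of the recovery Rec given the syndrome sigma. *)
Definition recovery_prob pQEC sigma (Rec : qpauli n) : R :=
  if sigma == dual0 S then (Rec == pi 1%g)%:R
  else (1 - pQEC) * (Rec == D sigma)%:R
       + pQEC * ((syn S Rec == sigma)%:R / #|[set F | syn S F == sigma]|%:R).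

Definition fidelity_Hyb p pDD pQEC : R :=
  \sum_E \sum_Rec error_prob p pDD E * recovery_prob pQEC (syn S E) Rec
                  * ((Rec * E)%g \in trivial_errors S)%:R.

Definition fidelity_QEC p pQEC : R := fidelity_Hyb p 1 pQEC.

End Protocol.

(* Main.v *)
(* At p_QEC = 0 the fidelity is the probability that the error is correctable,
   i.e. 1 - (a + p_DD b) / (u + p_DD v) with a = W(U \ K), b = W(V \ K),
   u = W(U), v = W(V).  The hypothesis b / v > a / u makes this strictly larger
   for p_DD < 1 than for p_DD = 1.  Both fidelities are affine in p_QEC, so the
   strict inequality persists for small p_QEC. *)
Require Import Defs.
From mathcomp Require Import all_boot all_order all_algebra all_fingroup.
From mathcomp Require Import reals.
From mathcomp Require Import ring lra.
Set Implicit Arguments.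
Unset Strict Implicit.
Unset Printing Implicit Defensive.
Import Order.TTheory GRing.Theory Num.Theory.
Local Open Scope ring_scope.

Lemma affine_lt_near0 (R : realFieldType) (a b c d : R) : a < c ->
  exists2 eps : R, 0 < eps &
    forall q : R, 0 <= q < eps -> a + q * b < c + q * d.
Proof.
rewrite -subr_gt0 => ac; have b1_gt0 : 0 < `|b - d| + 1 by rewrite ltr_wpDl.
(* The gap [c - a] exceeds [q * (b - d)] once [q] is below this quotient; the [+ 1] keeps the
   denominator positive when the slopes agree. *)
exists ((c - a) / (`|b - d| + 1)); first exact: divr_gt0.
move=> q /andP[q_ge0]; rewrite ltr_pdivlMr // => qac.
have : q * (b - d) <= q * `|b - d| by rewrite ler_wpM2l // ler_norm.
lra.
Qed.

(** After clearing the positive denominators, the two sides differ by exactly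
    [(1 - d) * (b * u - a * v)]. *)
Lemma mediant_lt (R : realFieldType) (a b u v d : R) :
  0 < u -> 0 < v -> 0 <= d < 1 -> a / u < b / v ->
  (a + d * b) / (u + d * v) < (a + b) / (u + v).
Proof.
move=> u_gt0 v_gt0 /andP[d_ge0 d_lt1].
rewrite ltr_pdivrMr // mulrAC ltr_pdivlMr // => abuv.
have duv_gt0 : 0 < u + d * v by rewrite ltr_wpDr // mulr_ge0 // ltW.
rewrite ltr_pdivrMr // mulrAC ltr_pdivlMr ?addr_gt0 //.
have : 0 < (1 - d) * (b * u - a * v) by rewrite mulr_gt0 // subr_gt0.
lra.
Qed.

Lemma odds_ge0 (R : realFieldType) (p : R) : 0 < p < 1 -> 0 <= p / (3 - 3 * p).
Proof. by case/andP=> p_gt0 p_lt1; rewrite divr_ge0 ?ltW //; lra. Qed.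

Section PauliWeights.
Variables (R : realType) (n : nat).
Implicit Types (A B : {set qpauli n}) (z : R).

Lemma wt_le (E : qpauli n) : (wt E <= n)%N.
Proof. by rewrite -[X in (_ <= X)%N]card_ord max_card. Qed.

Lemma wt1 : wt (1%g : qpauli n) = 0%N.
Proof.
rewrite -(morph1 [morphism of coset <[iI n]>]) /= wt_pi.
by apply/eqP; rewrite cards_eq0; apply/eqP/setP => i; rewrite !inE ffunE eqxx.
Qed.

Lemma weight_enumID A B z :
  weight_enum A z = weight_enum (A :&: B) z + weight_enum (A :\: B) z.
Proof. by rewrite /weight_enum (big_setID B). Qed.

Lemma weight_enum_ge0 A z : 0 <= z -> 0 <= weight_enum A z.
Proof. by move=> z_ge0; apply: sumr_ge0 => E _; rewrite exprn_ge0. Qed.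

Lemma weight_enum_gt0 A z : 1%g \in A -> 0 <= z -> 0 < weight_enum A z.
Proof.
move=> A1 z_ge0; rewrite /weight_enum (bigD1 1%g) //= wt1 expr0.
by rewrite ltr_wpDr ?ltr01 ?sumr_ge0 // => E _; rewrite exprn_ge0.
Qed.

Lemma unsuppressed1 (G : {group qpauli n}) : 1%g \in unsuppressed G.
Proof.
rewrite inE; apply/forall_inP => F _.
rewrite -[F]pi_repr -(morph1 [morphism of coset <[iI n]>]) /=.
by rewrite (qcommutes_pi 1%g) /commutes mulg1 mul1g.
Qed.

(** Each non-identity letter trades a factor [1 - p] for [p / 3], whose ratio is [z]. The prefactor
    does not depend on [E], so it cancels on normalization. *)
Lemma depolarizingE (p : R) (E : qpauli n) : p < 1 ->
  depolarizing p E = (1 - p) ^+ n * (p / (3 - 3 * p)) ^+ wt E.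
Proof.
move=> p_lt1; have p1_neq0 : 1 - p != 0 by rewrite subr_eq0 eq_sym lt_eqF.
have -> : p / (3 - 3 * p) = p / 3 / (1 - p).
  have -> : 3 - 3 * p = 3 * (1 - p) by ring.
  by field.
have -> : (1 - p) ^+ n = (1 - p) ^+ (n - wt E) * (1 - p) ^+ wt E.
  by rewrite -exprD subnK ?wt_le.
by rewrite -mulrA -exprMn mulrCA divff ?mulr1.
Qed.

(** Serves twice: with [A] the full set for the normalizing constant, and with [A] the correctable
    errors for the success probability. *)
Lemma sum_rescaled (G : {group qpauli n}) A (p d : R) : p < 1 ->
  \sum_(E in A) rescaled G p d E =
  (1 - p) ^+ n * (weight_enum (unsuppressed G :&: A) (p / (3 - 3 * p))
                  + d * weight_enum (suppressed G :&: A) (p / (3 - 3 * p))).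
Proof.
move=> p_lt1; rewrite (big_setID (unsuppressed G)) /= mulrDr setIC.
rewrite [suppressed G :&: A]setIC /suppressed -setDE /weight_enum.
rewrite !mulr_sumr; congr (_ + _); apply: eq_bigr => E.
  by case/setIP=> EU _; rewrite /rescaled inE EU mul1r depolarizingE.
by case/setDP=> _ EnU; rewrite /rescaled inE EnU depolarizingE // mulrCA.
Qed.

End PauliWeights.

Section Fidelity.
Variables (R : realType) (n : nat) (S : {group pauli n}).
Variables (D : dual S -> qpauli n) (G : {group qpauli n}).
Hypothesis D_dec : decoding_map D.
Implicit Types p d q : R.

(** Every [recovery_prob] is affine in [q], so the sum is determined by its values at 0 and 1. *)
Lemma fidelity_affine p d q :
  fidelity_Hyb D G p d q =
  fidelity_Hyb D G p d 0
  + q * (fidelity_Hyb D G p d 1 - fidelity_Hyb D G p d 0).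
Proof.
rewrite /fidelity_Hyb -sumrB mulr_sumr -big_split /=; apply: eq_bigr => E _.
rewrite -sumrB mulr_sumr -big_split /=; apply: eq_bigr => Rec _.
by rewrite /recovery_prob; case: ifP => _; ring.
Qed.

(** The zero-syndrome branch fits the same formula because a decoding map sends [dual0] to
    [pi 1]. *)
Lemma recovery_prob0 sigma (Rec : qpauli n) :
  recovery_prob D (0 : R) sigma Rec = (Rec == D sigma)%:R.
Proof.
rewrite /recovery_prob; case: eqP => [->|_]; last by ring.
by case: D_dec => -> _.
Qed.

Lemma fidelity_perfect_QEC p d :
  fidelity_Hyb D G p d 0 = \sum_(E in correctable D) error_prob G p d E.
Proof.
rewrite [RHS]big_mkcond; apply: eq_bigr => E _.
rewrite (bigD1 (D (syn S E))) //= big1 => [|Rec /negPf RecD].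
  by rewrite recovery_prob0 eqxx mulr1 addr0 inE; case: ifP; rewrite ?mulr1 ?mulr0.
by rewrite recovery_prob0 RecD mulr0 mul0r.
Qed.

Lemma fidelity_perfect_QECE p d (z := p / (3 - 3 * p))
    (K := correctable D) (U := unsuppressed G) (V := suppressed G) :
  0 < p < 1 -> 0 <= d ->
  fidelity_Hyb D G p d 0 =
  1 - (weight_enum (U :\: K) z + d * weight_enum (V :\: K) z)
      / (weight_enum U z + d * weight_enum V z).
Proof.
move=> p01 d_ge0; have /andP[_ p_lt1] := p01.
have z_ge0 : 0 <= z by rewrite /z odds_ge0.
(* The identity is unsuppressed and has weight 0, so the total stays positive even when [d = 0]. *)
have tot_gt0 : 0 < weight_enum U z + d * weight_enum V z.
  rewrite ltr_wpDr ?mulr_ge0 ?weight_enum_ge0 //.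
  by rewrite weight_enum_gt0 ?unsuppressed1.
rewrite fidelity_perfect_QEC -mulr_suml.
have -> : \sum_F rescaled G p d F = \sum_(F in setT) rescaled G p d F.
  by apply: eq_bigl => F; rewrite inE.
rewrite !sum_rescaled // !setIT -/z -/K -/U -/V.
rewrite -mulf_div divff ?mul1r; last by rewrite expf_neq0 // subr_eq0 gt_eqF.
(* Writing 1 as total over total leaves an identity of numerators: split [U] and [V] along [K]. *)
rewrite -[X in X - _](divff (lt0r_neq0 tot_gt0)) -mulrBl; congr (_ / _).
rewrite [weight_enum U z](weight_enumID U K).
by rewrite [weight_enum V z](weight_enumID V K); ring.
Qed.

End Fidelity.

Theorem corollary1 (R : realType) (n k : nat) (S : {group pauli n})
  (D : dual S -> qpauli n) (G : {group qpauli n}) (p z : R)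
  (hk : (1 <= k <= n)%N)
  (hS : stabilizer_group S k)
  (hD : decoding_map D)
  (hG : (G :!=: 1)%g)
  (hp : 0 < p < 1)
  (hz : z = p / (3 - 3 * p))
  (hVU : let K := correctable D in
         let U := unsuppressed G in
         let V := suppressed G in
         weight_enum (V :\: K) z / weight_enum V z
         > weight_enum (U :\: K) z / weight_enum U z) :
  forall pDD : R, 0 <= pDD < 1 ->
  exists2 eps : R, 0 < eps &
    forall pQEC : R, 0 <= pQEC < eps ->
      fidelity_Hyb D G p pDD pQEC > fidelity_QEC D G p pQEC.
Proof.
move=> d hd; have /andP[d_ge0 _] := hd.
have z_ge0 : 0 <= z by rewrite hz odds_ge0.
have U_gt0 : 0 < weight_enum (unsuppressed G) z.
  by rewrite weight_enum_gt0 ?unsuppressed1.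
(* If V were empty, its quotient would be the junk value x / 0 = 0. *)
have V_gt0 : 0 < weight_enum (suppressed G) z.
  rewrite lt_def weight_enum_ge0 // andbT; apply/eqP => V0; move: hVU.
  by rewrite /= V0 invr0 mulr0 ltNge divr_ge0 ?weight_enum_ge0.
have gap0 : fidelity_Hyb D G p 1 0 < fidelity_Hyb D G p d 0.
  rewrite !(fidelity_perfect_QECE _ hD hp) // -hz !mul1r.
  by rewrite ltrD2l ltrN2 mediant_lt.
have [eps eps_gt0 gap] := affine_lt_near0
  (fidelity_Hyb D G p 1 1 - fidelity_Hyb D G p 1 0)
  (fidelity_Hyb D G p d 1 - fidelity_Hyb D G p d 0) gap0.
by exists eps => // q /gap; rewrite -!fidelity_affine.
Qed.
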